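(* Let $m$ be a positive odd integer and $\mu=(m-1)/2$. For an odd prime $p$ denote \[ S_m = \sum_{k=0}^{\frac{p-1}{2}} (4k+1)^m \left( \frac{(1/2)_k}{(1)_k} \right)^4 . \] Then there exists an integer $a_m$ (depending only on $m$) such that for each odd prime $p>\mu$, \[ S_m \equiv \frac{a_m}{\mu!}\, p \pmod{p^4}. \]
   Context: $(a)_k = a(a+1)\cdots(a+k-1)$ is the rising factorial, with $(a)_0=1$. Congruences modulo $p^4$ between rational numbers are understood in the ring of rational numbers with denominator prime to $p$ (equivalently, in the $p$-adic integers).
   Formalization: The prime p = 3 is excluded for m = 1 and m = 3, where the claim fails: primes p > 3 force a_1 = 1 and a_3 = -1, but at p = 3 S_1 - 3 = -27/16 and S_3 + 3 = 189/16 are not divisible by 81. *)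

(* Defs.v *)
From HB Require Import structures.
From mathcomp Require Import all_boot all_order all_algebra.
Set Implicit Arguments.
Unset Strict Implicit.
Unset Printing Implicit Defensive.
Import GRing.Theory.
Local Open Scope ring_scope.

Definition rising (a : rat) (k : nat) : rat := \prod_(i < k) (a + i%:R).

(* [denq x] is the denominator of [x] in lowest terms, so this is membership
   in the localization of the integers at [p]. *)
Definition p_integral (p : nat) (x : rat) : bool := coprime p `|denq x|%N.

(* Congruence in the ring of [p]-integral rationals: both sides must belong to
   the ring, and their difference to the ideal generated by [N]. *)
Definition eqmod_local (p N : nat) (x y : rat) : Prop :=
  [/\ p_integral p x, p_integral p y
    & exists2 z : rat, p_integral p z & x - y = N%:R * z].

Definition S_sum (m p : nat) : rat :=
  \sum_(0 <= k < ((p - 1)./2).+1)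
    ((4 * k + 1)%:R) ^+ m * (rising (1 / 2%:R) k / rising 1 k) ^+ 4.

(* Main.v *)
Require Import Defs.
From HB Require Import structures.
From mathcomp Require Import all_boot all_order all_algebra.
From mathcomp Require Import ring lra zify.
Import Order.TTheory GRing.Theory Num.Theory.
Local Open Scope ring_scope.

(** Write p = 2n + 1, t_k = ((1/2)_k / k!)^4 and x = 4k + 1, so that S_m is the
    sum over k <= n of x^m t_k.  The proof reduces S_m to S_1 by telescoping,
    then evaluates S_1 modulo p^4.

    Reduction.  Since 2(2k+1) = x + 1 and 2(2k) = x - 1, for an even polynomial
    Q the sum of t_k [(x+1)^4 Q(x+2) - (x-1)^4 Q(x-2)] telescopes to a multiple
    of (2n+1)^4 t_n, which vanishes modulo p^4.  For Q = x^(2j) the bracket is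
    8 times an odd integer polynomial with leading term (j+1) x^(2j+3)
    ([telescoping_poly_exists]).  Hence (j+1) S_(2j+3) is an integer combination
    of S_1, S_3, ..., S_(2j+1), and by induction mu! S_m = a S_1 modulo p^4
    with an integer a that does not depend on p ([moment_descent]).

    Evaluation of S_1.  Put a second parameter Y in the summand:
      f(Y) = sum over k <= n of
        (4k+1) prod_(j<k) (2j+1)^2 ((2j+1)^2 - Y) / ((2j+2)^2 ((2j+2)^2 - Y)),
    so that f(0) = S_1.  This is a very well-poised 5F4, which terminates and
    sums to s at Y = s^2 for every odd s = 1, 3, ..., p ([wp_sum_odd]).
    After multiplication by the common denominator f becomes an integer
    polynomial F of degree at most n, and these n + 1 evaluations of F turn out
    to be congruent to each other modulo p^2: up to a common factor they are
    products of p terms of an arithmetic progression of difference 2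
    ([odd_square_value_step]).  The squares s^2 are distinct modulo p, so F is
    constant modulo p^2; in particular its linear coefficient vanishes modulo
    p^2, whence F(0) = F(p^2) modulo p^4 ([wp_poly_shift]).  The value F(p^2) is
    explicit, and for p > 3 it agrees modulo p^4 with p times the common
    denominator at Y = 0, because the linear coefficient of
    prod_j ((2j)^2 - Y) vanishes modulo p by Fermat's little theorem
    ([half_sq_shift]).  So S_1 = p modulo p^4 ([moment1_mod]).

    For p = 3 one only has S_1 = p modulo p^3.  The remaining exponent is m = 5,
    where 9 divides the numerator of S_5; this forces 3 to divide a, and the
    missing factor is recovered ([moment_descent_mod3]). *)

(** * Sums with cleared denominators *)

(** The sum of g k * prod_(j<k) (alpha j / beta j) over k <= n, multiplied by
    prod_(j<n) beta j: it makes sense in any commutative ring and commutes with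
    ring morphisms, so that one expression serves as an integer, as a polynomial
    and as a rational number. *)
Definition cleared_sum {R : comRingType} (alpha beta g : nat -> R) (n : nat) : R :=
  \sum_(k < n.+1) g k * (\prod_(j < k) alpha j) * \prod_(k <= j < n) beta j.

Section ClearedSum.
Variable R : comRingType.
Implicit Types alpha beta g : nat -> R.

Lemma cleared_sum0 alpha beta g : cleared_sum alpha beta g 0 = g 0%N.
Proof. by rewrite /cleared_sum big_ord1 big_ord0 big_geq ?mulr1. Qed.

Lemma cleared_sumS alpha beta g n :
  cleared_sum alpha beta g n.+1 =
    cleared_sum alpha beta g n * beta n + g n.+1 * \prod_(j < n.+1) alpha j.
Proof.
rewrite /cleared_sum big_ord_recr /= [in X in _ + X]big_geq // mulr1.
rewrite mulr_suml; congr (_ + _); apply: eq_bigr => k _.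
by rewrite big_nat_recr ?mulrA //= -ltnS ltn_ord.
Qed.

Lemma eq_cleared_sum alpha beta g alpha' beta' g' n :
    alpha =1 alpha' -> beta =1 beta' -> g =1 g' ->
  cleared_sum alpha beta g n = cleared_sum alpha' beta' g' n.
Proof.
move=> eq_a eq_b eq_g; apply: eq_bigr => k _.
by congr (_ * _ * _); [exact: eq_g | exact: eq_bigr | exact: eq_bigr].
Qed.

Lemma cleared_sumD alpha beta g h n :
  cleared_sum alpha beta (fun k => g k + h k) n =
    cleared_sum alpha beta g n + cleared_sum alpha beta h n.
Proof. by rewrite -big_split; apply: eq_bigr => k _; rewrite !mulrDl. Qed.

Lemma cleared_sumZ alpha beta c g n :
  cleared_sum alpha beta (fun k => c * g k) n = c * cleared_sum alpha beta g n.
Proof. by rewrite mulr_sumr; apply: eq_bigr => k _; rewrite !mulrA. Qed.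

(** The summand is the difference of consecutive values of the sequence
    c (k - 1) * prod_(j<k) alpha j / prod_(j<k-1) beta j, whose value at k = 0
    is 0; only the upper end of the telescoping sum survives. *)
Lemma cleared_sum_telescope alpha beta c g n :
    g 0%N = c 0%N * alpha 0%N ->
    (forall k, g k.+1 = c k.+1 * alpha k.+1 - c k * beta k) ->
  cleared_sum alpha beta g n = c n * \prod_(j < n.+1) alpha j.
Proof.
move=> g0 gS; elim: n => [|n IHn]; first by rewrite cleared_sum0 big_ord1.
by rewrite cleared_sumS IHn gS [in RHS]big_ord_recr /=; ring.
Qed.

End ClearedSum.

Lemma rmorph_cleared_sum {R S : comRingType} (phi : {rmorphism R -> S})
    (alpha beta g : nat -> R) n :
  phi (cleared_sum alpha beta g n) =
    cleared_sum (phi \o alpha) (phi \o beta) (phi \o g) n.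
Proof. by rewrite rmorph_sum; apply: eq_bigr => k _; rewrite !rmorphM !rmorph_prod. Qed.

Lemma cleared_sum_field {F : fieldType} (alpha beta g : nat -> F) n :
    (forall j, (j < n)%N -> beta j != 0) ->
  cleared_sum alpha beta g n =
    (\prod_(j < n) beta j) * \sum_(k < n.+1) g k * \prod_(j < k) (alpha j / beta j).
Proof.
move=> nz_beta; rewrite mulr_sumr; apply: eq_bigr => k _.
have le_kn: (k <= n)%N by rewrite -ltnS ltn_ord.
have -> : \prod_(j < n) beta j = (\prod_(j < k) beta j) * \prod_(k <= j < n) beta j.
  by rewrite -!(big_mkord xpredT beta) -big_cat_nat.
rewrite prodf_div; have nz: \prod_(j < k) beta j != 0.
  by apply/prodf_neq0 => j _; apply: nz_beta; apply: leq_trans le_kn.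
by field.
Qed.

(** * Reduction to the first moment *)

(** The sum of x w(x^2) t_k, with x = 4k + 1, cleared of its denominator; S_m is
    the case w = 'X^mu with m = 2 mu + 1. *)
Definition moment (w : {poly int}) (n : nat) : int :=
  cleared_sum (fun j => (2 * j + 1)%:R ^+ 4) (fun j => (2 * j + 2)%:R ^+ 4)
    (fun k => (4 * k + 1)%:R * w.[(4 * k + 1)%:R ^+ 2]) n.

Lemma momentD v w n : moment (v + w) n = moment v n + moment w n.
Proof.
rewrite -cleared_sumD; apply: eq_cleared_sum => // k.
by rewrite hornerD mulrDr.
Qed.

Lemma momentZ c w n : moment (c *: w) n = c * moment w n.
Proof.
rewrite -cleared_sumZ; apply: eq_cleared_sum => // k.
by rewrite hornerZ; ring.
Qed.

(** The right-hand side is odd in x, hence x times a polynomial in y = x^2.  Both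
    (x + 2)^2 and (x - 2)^2 are roots of z^2 = 2 (y + 4) z - (y - 4)^2, so these
    polynomials obey the recurrence W_(j+2) = 2 (y + 4) W_(j+1) - (y - 4)^2 W_j,
    which keeps them integral; their leading coefficients are then 1, 2, 3, ... *)
Lemma telescoping_poly_exists (j : nat) :
  exists W : {poly int}, [/\ (size W <= j.+2)%N, W`_j.+1 = j.+1%:R
    & forall x : int, 8 * (x * W.[x ^+ 2]) =
        (x + 1) ^+ 4 * (x + 2) ^+ (2 * j) - (x - 1) ^+ 4 * (x - 2) ^+ (2 * j)].
Proof.
pose P j (W : {poly int}) := [/\ (size W <= j.+2)%N, W`_j.+1 = j.+1%:R
    & forall x : int, 8 * (x * W.[x ^+ 2]) =
        (x + 1) ^+ 4 * (x + 2) ^+ (2 * j) - (x - 1) ^+ 4 * (x - 2) ^+ (2 * j)].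
suff [W [_ [PW _]]]: exists W W', P j W /\ P j.+1 W' by exists W.
elim: j => [|j [W [W' [PW PW']]]].
  exists ('X + 1), (2%:R *: 'X^2 + 11%:R *: 'X + 5%:R *: 1).
  split; split.
  - by rewrite -polyC1 size_XaddC.
  - by rewrite coefD coefX coef1.
  - by move=> x; rewrite hornerD hornerX hornerC muln0; ring.
  - apply/leq_sizeP => i lt3i; rewrite !coefD !coefZ coefXn coefX coef1.
    by case: i lt3i => [|[|[|i]]].
  - by rewrite !coefD !coefZ coefXn coefX coef1.
  - by move=> x; rewrite !(hornerD, hornerZ, hornerXn, hornerX, hornerC) muln1; ring.
case: PW PW' => [szW cW hW] [szW' cW' hW'].
(* This is 2 (X + 4) W' - (X - 4)^2 W, expanded to make coefficients visible. *)
exists W', (2%:R *: ('X * W') + 8%:R *: W'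
   - ('X * ('X * W)) + 8%:R *: ('X * W) - 16%:R *: W).
split; split=> //.
- apply/leq_sizeP => i lt_ji.
  have zW k: (j.+2 <= k)%N -> W`_k = 0 by move/leq_sizeP: szW; apply.
  have zW' k: (j.+3 <= k)%N -> W'`_k = 0 by move/leq_sizeP: szW'; apply.
  case: i lt_ji => [|[|i]] // lt_ji.
  rewrite !(coefD, coefN, coefZ, coefXM) /= !zW ?zW' ?zW //; lia.
- rewrite !(coefD, coefN, coefZ, coefXM) /= cW cW'.
  have zW k: (j.+2 <= k)%N -> W`_k = 0 by move/leq_sizeP: szW; apply.
  have zW' k: (j.+3 <= k)%N -> W'`_k = 0 by move/leq_sizeP: szW'; apply.
  by rewrite !zW ?zW' //; ring.
- move=> x; have := hW x; have := hW' x.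
  rewrite !(hornerD, hornerN, hornerZ, hornerM, hornerX).
  rewrite !mulnS !exprD; set y := W.[_]; set y' := W'.[_].
  set u := (x + 2) ^+ (2 * j); set v := (x - 2) ^+ (2 * j) => e' e.
  transitivity (2 * (x ^+ 2 + 4) * (8 * (x * y')) - (x ^+ 2 - 4) ^+ 2 * (8 * (x * y))); first by ring.
  by rewrite e e'; ring.
Qed.

(** With Q(x) = x^(2j) the summand telescopes, and the surviving end contains
    (2n + 1)^4. *)
Lemma dvdz_moment_telescoping W j n :
    (forall x : int, 8 * (x * W.[x ^+ 2]) =
        (x + 1) ^+ 4 * (x + 2) ^+ (2 * j) - (x - 1) ^+ 4 * (x - 2) ^+ (2 * j)) ->
  ((2 * n + 1)%:R ^+ 4 %| moment W n)%Z.
Proof.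
move=> defW; pose c k : int := 2 * (4 * k + 3)%:R ^+ (2 * j).
have eight_neq0: (8 : int) != 0 by [].
rewrite /moment (@cleared_sum_telescope _ _ _ c).
- by rewrite big_ord_recr /= mulrA dvdz_mull.
- apply: (mulfI eight_neq0); rewrite defW /c.
  by rewrite (_ : (4 * 0 + 3)%:R = 3) //; ring.
move=> k; apply: (mulfI eight_neq0); rewrite defW /c.
rewrite (_ : _%:R + 2 = (4 * k.+1 + 3)%:R); last by ring.
rewrite (_ : _%:R - 2 = (4 * k + 3)%:R); last by ring.
by ring.
Qed.

(** Subtracting a multiple of the telescoping polynomial of degree mu + 1 from
    (mu + 1) w lowers the degree; the factors mu + 1 accumulate to the factorial.
    No step involves n, so a is uniform in n. *)
Lemma moment_descent mu (w : {poly int}) : (size w <= mu.+1)%N ->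
  exists a : int, forall n,
    ((2 * n + 1)%:R ^+ 4 %| mu`!%:R * moment w n - a * moment 1 n)%Z.
Proof.
elim: mu w => [|mu IHmu] w sz_w.
  exists w`_0 => n; rewrite (size1_polyC sz_w) coefC /= -alg_polyC momentZ.
  by rewrite fact0 mul1r subrr dvdz0.
have [W [szW cW defW]] := telescoping_poly_exists mu.
pose v := mu.+1%:R *: w - w`_mu.+1 *: W.
have sz_v: (size v <= mu.+1)%N.
  apply/leq_sizeP => i; rewrite leq_eqVlt => /predU1P[<-|lt_i].
    by rewrite coefB !coefZ cW mulrC subrr.
  move/leq_sizeP: sz_w => zw; move/leq_sizeP: szW => zW.
  by rewrite coefB !coefZ (zw i) // zW // !mulr0 subrr.
have [a Ha] := IHmu v sz_v; exists a => n.
have := dvdz_mull (mu`!%:R * w`_mu.+1) (@dvdz_moment_telescoping W mu n defW).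
move/(rpredD (Ha n)); congr (_ %| _)%Z.
rewrite /v momentD -scaleNr !momentZ factS natrM; ring.
Qed.

(** * A well-poised hypergeometric sum *)

Definition wp_num {R : comRingType} (Y : R) (j : nat) : R :=
  (2 * j + 1)%:R ^+ 2 * ((2 * j + 1)%:R ^+ 2 - Y).

Definition wp_den {R : comRingType} (Y : R) (j : nat) : R :=
  (2 * j + 2)%:R ^+ 2 * ((2 * j + 2)%:R ^+ 2 - Y).

Definition wp_term (s : rat) (k : nat) : rat :=
  \prod_(j < k) (wp_num (s ^+ 2) j / wp_den (s ^+ 2) j).

Lemma wp_termS s k :
  wp_term s k.+1 = wp_term s k * (wp_num (s ^+ 2) k / wp_den (s ^+ 2) k).
Proof. by rewrite /wp_term big_ord_recr. Qed.

(** In the ratio of the two terms all but the outer factors cancel.  The term of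
    index k + 1 is compared with that of index k because then the factor
    s + 1 - 2k, which may vanish, cancels as well. *)
Lemma wp_term_shift (s : rat) k : 0 < s -> (forall j, s != (2 * j)%:R) ->
  wp_term (s + 2) k.+1 = wp_term s k *
    ((s + 2) * (2 * k + 1)%:R ^+ 2 * (s + (2 * k + 1)%:R) * (s + (2 * k + 3)%:R)
     / (s * (s + (2 * k + 2)%:R) * (2 * k + 2)%:R ^+ 2 * (s + (2 * k + 4)%:R))).
Proof.
move=> s_gt0 s_odd; elim: k => [|k IHk].
  rewrite /wp_term big_ord1 big_ord0 /wp_num /wp_den !subr_sqr /=.
  field; do ?[apply/andP; split]; try by apply: lt0r_neq0; lra.
  by rewrite opprD addrCA subrr addr0 oppr_eq0 lt0r_neq0.
rewrite wp_termS IHk wp_termS -!mulrA; congr (_ * _).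
rewrite /wp_num /wp_den !subr_sqr.
have k_ge0: 0 <= k%:R :> rat by [].
have den_neq0 : 2 * k%:R + 2 - s != 0.
  by rewrite (_ : _ + 2 = (2 * k.+1)%:R); [rewrite subr_eq0 eq_sym | ring].
by field; do ?[apply/andP; split]=> //; apply: lt0r_neq0; lra.
Qed.

(** A Wilf-Zeilberger pair: the difference of the summands for s + 2 and s, each
    divided by its parameter, is a forward difference in k, so the partial sums
    differ by a single hypergeometric term. *)
Lemma wp_sum_contiguous (s : rat) K : 0 < s -> (forall j, s != (2 * j)%:R) ->
  s * \sum_(k < K.+1) (4 * k + 1)%:R * wp_term (s + 2) k
  - (s + 2) * \sum_(k < K.+1) (4 * k + 1)%:R * wp_term s k =
  - (2 * (s + 2) / (s + 1) * (2 * K + 1)%:R ^+ 2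
     * ((s + (2 * K + 1)%:R) / (s + (2 * K + 2)%:R)) * wp_term s K).
Proof.
move=> s_gt0 s_odd; elim: K => [|K IHK].
  rewrite !big_ord1 /wp_term !big_ord0 /=.
  by field; do ?[apply/andP; split]; apply: lt0r_neq0; lra.
rewrite big_ord_recr [in X in _ - X]big_ord_recr /= mulrDr [(s + 2) * _]mulrDr opprD addrACA IHK.
rewrite wp_term_shift // wp_termS.
rewrite /wp_num /wp_den !subr_sqr.
have K_ge0: 0 <= K%:R :> rat by [].
have den_neq0 : 2 * K%:R + 2 - s != 0.
  by rewrite (_ : _ + 2 = (2 * K.+1)%:R); [rewrite subr_eq0 eq_sym | ring].
by field; do ?[apply/andP; split]=> //; apply: lt0r_neq0; lra.
Qed.

Lemma odd_neq_even {R : numDomainType} (i j : nat) :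
  (2 * i + 1)%:R != (2 * j)%:R :> R.
Proof. by rewrite eqr_nat; lia. Qed.

Lemma wp_term_eq0 (i k : nat) : (i < k)%N -> wp_term (2 * i + 1)%:R k = 0.
Proof.
move=> lt_ik; rewrite /wp_term (bigD1 (Ordinal lt_ik)) //=.
by rewrite /wp_num subrr mulr0 mul0r mul0r.
Qed.

Lemma wp_sum_stable (i n : nat) : (i <= n)%N ->
  \sum_(k < n.+1) (4 * k + 1)%:R * wp_term (2 * i + 1)%:R k =
  \sum_(k < i.+1) (4 * k + 1)%:R * wp_term (2 * i + 1)%:R k.
Proof.
elim: n => [|n IHn]; first by case: i.
rewrite leq_eqVlt => /predU1P[->//|lt_in].
by rewrite big_ord_recr /= wp_term_eq0 ?mulr0 ?addr0 ?IHn.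
Qed.

(** For odd s the sum terminates, the right-hand side of the contiguous relation
    vanishes, and sum / s is the same for s and s + 2. *)
Lemma wp_sum_odd (i n : nat) : (i <= n)%N ->
  \sum_(k < n.+1) (4 * k + 1)%:R * wp_term (2 * i + 1)%:R k = (2 * i + 1)%:R.
Proof.
move/wp_sum_stable->; elim: i => [|i IHi].
  by rewrite big_ord1 /wp_term big_ord0.
have s_gt0: 0 < (2 * i + 1)%:R :> rat by rewrite ltr0n addn1.
have := @wp_sum_contiguous _ i.+1 s_gt0 (odd_neq_even i).
rewrite wp_term_eq0 // mulr0 oppr0 (_ : _%:R + 2 = (2 * i.+1 + 1)%:R); last by ring.
rewrite wp_sum_stable // IHi => /eqP; rewrite subr_eq0 mulrC => /eqP.
by apply: mulIf; apply: lt0r_neq0.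
Qed.

Lemma rmorph_wp_num {R S : comRingType} (phi : {rmorphism R -> S}) (Y : R) j :
  phi (wp_num Y j) = wp_num (phi Y) j.
Proof. by rewrite rmorphM rmorphB !rmorphXn !rmorph_nat. Qed.

Lemma rmorph_wp_den {R S : comRingType} (phi : {rmorphism R -> S}) (Y : R) j :
  phi (wp_den Y j) = wp_den (phi Y) j.
Proof. by rewrite rmorphM rmorphB !rmorphXn !rmorph_nat. Qed.

(** * The first moment modulo the fourth power of p *)

Definition wp_poly {R : comRingType} (Y : R) : nat -> R :=
  cleared_sum (wp_num Y) (wp_den Y) (fun k => (4 * k + 1)%:R).

Lemma rmorph_wp_poly {R S : comRingType} (phi : {rmorphism R -> S}) (Y : R) n :
  phi (wp_poly Y n) = wp_poly (phi Y) n.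
Proof.
rewrite rmorph_cleared_sum; apply: eq_cleared_sum => j /=.
- exact: rmorph_wp_num.
- exact: rmorph_wp_den.
- exact: rmorph_nat.
Qed.

Lemma horner_wp_poly (y : int) n : (wp_poly 'X n).[y] = wp_poly y n.
Proof. by rewrite -[LHS]/(horner_eval y _) rmorph_wp_poly /= /horner_eval hornerX. Qed.

Lemma wp_poly_odd (i n : nat) : (i <= n)%N ->
  wp_poly ((2 * i + 1)%:R ^+ 2) n =
    (2 * i + 1)%:R * \prod_(j < n) wp_den ((2 * i + 1)%:R ^+ 2) j :> int.
Proof.
move=> le_in; apply: (@intr_inj rat).
rewrite rmorph_wp_poly [RHS]rmorphM rmorph_prod /= rmorphXn rmorph_nat.
rewrite /wp_poly cleared_sum_field => [|j _].
  rewrite wp_sum_odd // mulrC; congr (_ * _); first by rewrite rmorph_nat.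
  apply: eq_bigr => j _.
  by rewrite rmorph_wp_den rmorphXn rmorph_nat.
rewrite /wp_den subr_sqr; apply: mulf_neq0; last apply: mulf_neq0.
- by rewrite expf_neq0 // pnatr_eq0; lia.
- rewrite subr_eq0 eq_sym (_ : (2 * j + 2)%N = (2 * j.+1)%N) ?odd_neq_even //; lia.
- by rewrite -natrD pnatr_eq0; lia.
Qed.

Lemma size_prod_linear_leq {R : comNzRingType} (F : nat -> {poly R}) n :
  (forall j, (size (F j) <= 2)%N) -> (size (\prod_(j < n) F j)%R <= n.+1)%N.
Proof.
move=> szF; elim: n => [|n IHn]; first by rewrite big_ord0 size_poly1.
rewrite big_ord_recr /=; apply: leq_trans (size_polyMleq _ _) _.
rewrite -subn1 leq_subLR add1n.
by rewrite -addn2 leq_add.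
Qed.

Lemma size_wp_factor (c d : int) : (size (c%:P * (d%:P - 'X))%R <= 2)%N.
Proof.
by apply/leq_sizeP => -[|[|i]] // _; rewrite coefCM coefB coefC coefX subrr mulr0.
Qed.

Lemma size_wp_num j : (size (wp_num ('X : {poly int}) j) <= 2)%N.
Proof. by rewrite /wp_num -polyC_natr -polyC_exp size_wp_factor. Qed.

Lemma size_wp_den j : (size (wp_den ('X : {poly int}) j) <= 2)%N.
Proof. by rewrite /wp_den -polyC_natr -polyC_exp size_wp_factor. Qed.

Lemma size_wp_poly n : (size (wp_poly ('X : {poly int}) n) <= n.+1)%N.
Proof.
rewrite /wp_poly; elim: n => [|n IHn].
  by rewrite cleared_sum0 -polyC_natr size_polyC_leq1.
rewrite cleared_sumS; apply: leq_trans (size_polyD _ _) _; rewrite geq_max.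
apply/andP; split; apply: leq_trans (size_polyMleq _ _) _.
  rewrite -subn1 leq_subLR add1n -[n.+3]addn2 leq_add ?size_wp_den //.
rewrite -subn1 leq_subLR leq_add // -?polyC_natr ?size_polyC_leq1 //.
exact: size_prod_linear_leq size_wp_num.
Qed.

(** Lagrange's bound on the number of roots, modulo an integer M that need not be
    prime: it holds as soon as the differences of the roots are invertible
    modulo M. *)
Lemma dvdz_coef_of_roots (M : int) (x : nat -> int) n (g : {poly int}) :
    (size g <= n)%N ->
    (forall i, (i < n)%N -> (M %| g.[x i])%Z) ->
    (forall i j, (i < j < n)%N -> coprimez M (x j - x i)) ->
  forall k, (M %| g`_k)%Z.
Proof.
elim: n g => [|n IHn] g sz_g gx cop k.
  by rewrite (size_poly_leq0P _ sz_g) coef0 dvdz0.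
have /factor_theorem[q def_q]: root (g - g.[x n]%:P) (x n).
  by rewrite rootE hornerD hornerN hornerC subrr.
have sz_q: (size q <= n)%N.
  have [->|nz_q] := eqVneq q 0; first by rewrite size_poly0.
  have: (size (q * ('X - (x n)%:P))%R <= n.+1)%N.
    rewrite -def_q (leq_trans (size_polyD _ _)) // geq_max sz_g size_polyN.
    by rewrite (leq_trans (size_polyC_leq1 _)).
  by rewrite size_Mmonic ?monicXsubC // size_XsubC addn2.
have defg: g = q * ('X - (x n)%:P) + g.[x n]%:P by rewrite -def_q subrK.
have qx i: (i < n)%N -> (M %| q.[x i])%Z.
  move=> lt_in; rewrite -(@Gauss_dvdzl _ _ (x n - x i)) ?cop ?lt_in ?ltnSn //.
  have: (M %| g.[x n] - g.[x i])%Z by rewrite rpredB ?gx // ltnW.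
  congr (_ %| _)%Z; rewrite [in g.[x i]]defg !hornerE; ring.
have dvd_q j : (M %| q`_j)%Z.
  apply: IHn qx _ j => // i j /andP[lt_ij lt_jn].
  by rewrite cop // lt_ij ltnW.
rewrite defg mulrBr coefD coefB coefMX coefMC coefC.
apply: rpredD; first apply: rpredB.
- by case: ifP => _; rewrite ?dvdz0.
- exact: dvdz_mulr.
- by case: ifP => _; rewrite ?dvdz0 ?gx.
Qed.

Lemma horner_mod_sqr (f : {poly int}) (y : int) :
  exists z, f.[y] = f`_0 + f`_1 * y + z * y ^+ 2.
Proof.
exists (drop_poly 2 f).[y].
rewrite -{1}(poly_take_drop 2 f) hornerD hornerM hornerXn; congr (_ + _).
by rewrite /take_poly horner_poly !big_ord_recl big_ord0 /=; ring.
Qed.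

(** The square of this is the common denominator of the sums S_m; it is prime to
    2n + 1 when the latter is prime. *)
Definition half_sq (n : nat) : int := \prod_(j < n) (2 * j + 2)%:R ^+ 2.

Definition odd_square_value (n i : nat) : int :=
  (2 * i + 1)%:R * \prod_(j < n) ((2 * j + 2)%:R ^+ 2 - (2 * i + 1)%:R ^+ 2).

Lemma wp_poly_odd_square n i : (i <= n)%N ->
  wp_poly ((2 * i + 1)%:R ^+ 2) n = half_sq n * odd_square_value n i.
Proof. by move=> le_in; rewrite wp_poly_odd // big_split /= mulrCA. Qed.

(** With s = 2i + 1 the value is (-1)^n times the product of the 2n + 1 numbers
    s - 2n, s - 2n + 2, ..., s + 2n.  Passing from s to s + 2 replaces s - 2n by
    s + 2n + 2, a change by twice 2n + 1, and one of the common factors is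
    2n + 1 itself. *)
Lemma odd_square_value_step n i : (i < n)%N ->
  ((2 * n + 1)%:R ^+ 2 %| odd_square_value n i.+1 - odd_square_value n i)%Z.
Proof.
case: n => // n lt_in.
pose D j : int := (2 * j + 1)%:R - (2 * i)%:R.
pose E j : int := (2 * j + 3)%:R + (2 * i)%:R.
pose A := \prod_(j < n) D j; pose B := \prod_(j < n.+1) E j.
have def_i : odd_square_value n.+1 i = (2 * i + 1)%:R * (A * D n * B).
  have -> : A * D n = \prod_(j < n.+1) D j by rewrite big_ord_recr.
  congr (_ * _); rewrite -big_split; apply: eq_bigr => j _.
  by rewrite /D /E /=; ring.
have def_i1 : odd_square_value n.+1 i.+1 = - (2 * i + 1)%:R * A * (B * E n.+1).
  have -> : B * E n.+1 = \prod_(j < n.+2) E j by rewrite big_ord_recr.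
  rewrite big_ord_recl mulrA [_ * E ord0]mulrC -mulrA.
  congr (_ * _); first by rewrite /E /=; ring.
  have -> : - (2 * i + 1)%:R * A = \prod_(j < n.+1) (D j - 2).
    rewrite big_ord_recl; congr (_ * _); first by rewrite /D /=; ring.
    by apply: eq_bigr => j _; rewrite /D lift0; ring.
  rewrite -big_split; apply: eq_bigr => j _.
  by rewrite /D /E lift0 /=; ring.
have dvd_B : ((2 * n.+1 + 1)%:R %| B)%Z.
  have lt_j : (n - i < n.+1)%N by rewrite ltnS leq_subr.
  rewrite /B (bigD1 (Ordinal lt_j)) //= dvdz_mulr // /E -natrD.
  by rewrite (_ : (2 * (n - i) + 3 + 2 * i)%N = (2 * n.+1 + 1)%N) //; lia.
have -> : odd_square_value n.+1 i.+1 - odd_square_value n.+1 i =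
   (-2 * A * (2 * i + 1)%:R) * ((2 * n.+1 + 1)%:R * B).
  by rewrite def_i def_i1 /D /E; ring.
by rewrite dvdz_mull // dvdz_mul.
Qed.

Lemma wp_poly_odd_square_mod n i : (i <= n)%N ->
  ((2 * n + 1)%:R ^+ 2 %|
     wp_poly ((2 * i + 1)%:R ^+ 2) n - wp_poly ((2 * n + 1)%:R ^+ 2) n)%Z.
Proof.
move=> le_in; rewrite !wp_poly_odd_square // -mulrBr dvdz_mull //.
rewrite -opprB rpredN -(telescope_sumr _ le_in) big_nat.
by apply: rpred_sum => j /andP[_ lt_jn]; apply: odd_square_value_step.
Qed.

Lemma coprime_small_prime p k : prime p -> (0 < k < p)%N -> coprime p k.
Proof.
by move=> p_pr /andP[k_gt0 lt_kp]; rewrite prime_coprime // gtnNdvd.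
Qed.

Lemma coprimez_4mul p (a b : nat) : prime p -> odd p ->
  (0 < a < p)%N -> (0 < b < p)%N -> coprimez p%:R (4 * (a%:R * b%:R)).
Proof.
move=> p_pr p_odd a_small b_small.
rewrite -!natrM coprimezE !natz /= !coprimeMr (@coprimeXr 2 _ 2) ?coprimen2 //.
by rewrite !coprime_small_prime.
Qed.

(** The polynomial is constant modulo p^2 by Lagrange's bound at the n + 1 points
    1, 9, 25, ..., p^2.  Its linear coefficient contributes p^2 * p^2 to the
    difference and the higher ones contain (p^2)^2. *)
Lemma wp_poly_shift n : prime (2 * n + 1) ->
  ((2 * n + 1)%:R ^+ 4 %| wp_poly 0 n - wp_poly ((2 * n + 1)%:R ^+ 2) n)%Z.
Proof.
set p := (2 * n + 1)%N => p_pr.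
pose K : int := wp_poly (p%:R ^+ 2) n; pose f := wp_poly ('X : {poly int}) n.
have dvd_coef k : (p%:R ^+ 2 %| (f - K%:P)`_k)%Z.
  apply: (@dvdz_coef_of_roots _ (fun i => (2 * i + 1)%:R ^+ 2) n.+1).
  - rewrite (leq_trans (size_polyD _ _)) // geq_max size_wp_poly size_polyN.
    by rewrite (leq_trans (size_polyC_leq1 _)).
  - move=> i lt_in; rewrite hornerD hornerN hornerC horner_wp_poly.
    exact: wp_poly_odd_square_mod.
  - move=> i j /andP[lt_ij lt_jn]; rewrite coprimezXl //.
    rewrite (_ : _ - _ = 4 * ((i + j + 1)%:R * (j - i)%:R)).
      by apply: coprimez_4mul => //; rewrite /p; lia.
    by rewrite [(j - i)%:R]natrB ?(ltnW lt_ij) //; ring.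
have [z fp] := horner_mod_sqr f (p%:R ^+ 2).
have [z0 f0] := horner_mod_sqr f 0.
rewrite !horner_wp_poly in fp f0.
rewrite fp f0; have := dvd_coef 1%N; rewrite coefB coefC subr0 => dvd_f1.
rewrite (_ : _ - _ = - (p%:R ^+ 2 * f`_1) - z * p%:R ^+ 4); last by ring.
rewrite rpredB ?rpredN //; last exact: dvdz_mull.
by rewrite -[4%N]/(2 + 2)%N exprD dvdz_mul.
Qed.

Lemma fermat_dvdz p (x : nat) : prime p -> coprime p x ->
  (p%:Z %| x%:R ^+ p.-1 - 1)%Z.
Proof.
move=> p_pr cop; have cop_z : coprimez p x%:R by rewrite natz.
rewrite -(Gauss_dvdzr _ cop_z).
rewrite mulrBr mulr1 -exprS prednK ?prime_gt0 // -natrX !natz.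
by rewrite -eqz_mod_dvd !modz_nat fermat_little.
Qed.

(** Modulo p the nonzero squares are exactly the roots of 'X^n - 1, so the product
    of the 'X - (2j+2)^2 is congruent to 'X^n - 1, which has no linear term since
    n > 1.  This is where p = 3 has to be excluded. *)
Lemma half_sq_shift n : prime (2 * n + 1) -> (1 < n)%N ->
  ((2 * n + 1)%:R ^+ 3 %|
     \prod_(j < n) ((2 * j + 2)%:R ^+ 2 - (2 * n + 1)%:R ^+ 2) - half_sq n)%Z.
Proof.
set p := (2 * n + 1)%N => p_pr n_gt1.
pose E : {poly int} := \prod_(j < n) ('X - ((2 * j + 2)%:R ^+ 2)%:P).
have defE (y : int) : E.[y] = \prod_(j < n) (y - (2 * j + 2)%:R ^+ 2).
  by rewrite horner_prod; apply: eq_bigr => j _; rewrite hornerXsubC.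
have size_E : size E = n.+1.
  by rewrite size_prod_XsubC [index_enum _]unlock -enumT size_enum_ord.
have monic_E : E \is monic by apply: monic_prod_XsubC.
have dvd_coef k : (p%:R %| (E - ('X^n - 1))`_k)%Z.
  apply: (@dvdz_coef_of_roots _ (fun j => (2 * j + 2)%:R ^+ 2) n).
  - apply/leq_sizeP => k' le_nk; rewrite !coefB coefXn coef1.
    have [def_k|ne_k] := eqVneq k' n.
      move/monicP: monic_E; rewrite lead_coefE size_E /= def_k => ->.
      by rewrite gtn_eqF ?subr0 ?subrr // ltnW.
    rewrite nth_default ?size_E; last by lia.
    by rewrite gtn_eqF ?subr0 //; apply: leq_trans le_nk; apply: ltnW.
  - move=> j lt_jn; rewrite -polyC1 !(hornerD, hornerN, hornerXn, hornerC) defE.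
    rewrite (bigD1 (Ordinal lt_jn)) //= subrr mul0r sub0r rpredN -exprM.
    have -> : (2 * n)%N = p.-1 by rewrite /p addn1.
    rewrite [p%:R]natz; apply: fermat_dvdz => //; apply: coprime_small_prime => //.
    by rewrite /p; lia.
  - move=> i j /andP[lt_ij lt_jn].
    rewrite (_ : _ - _ = 4 * ((i + j + 2)%:R * (j - i)%:R)).
      by apply: coprimez_4mul => //; rewrite /p; lia.
    by rewrite [(j - i)%:R]natrB ?(ltnW lt_ij) //; ring.
have [z Ep] := horner_mod_sqr E (p%:R ^+ 2).
have [z0 E0] := horner_mod_sqr E 0.
have flip y : \prod_(j < n) ((2 * j + 2)%:R ^+ 2 - y) = (-1) ^+ n * E.[y].
  rewrite defE -[X in _ ^+ X]card_ord -prodrN. 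
  by apply: eq_bigr => j _; rewrite opprB.
have -> : half_sq n = (-1) ^+ n * E.[0].
  by rewrite -flip; apply: eq_bigr => j _; rewrite subr0.
rewrite flip -mulrBr dvdz_mull // Ep E0.
have := dvd_coef 1%N; rewrite !coefB coefXn coef1.
rewrite (_ : (1 == n)%N = false) ?subr0; last by lia.
move=> dvd_E1.
rewrite (_ : _ - _ = p%:R ^+ 2 * E`_1 + z * p%:R * p%:R ^+ 3); last by ring.
rewrite rpredD //; last exact: dvdz_mull.
by rewrite -[3%N]/(2 + 1)%N exprD dvdz_mul.
Qed.

Lemma moment1_mod n : prime (2 * n + 1) -> (1 < n)%N ->
  ((2 * n + 1)%:R ^+ 4 %| moment 1 n - (2 * n + 1)%:R * half_sq n ^+ 2)%Z.
Proof.
move=> p_pr n_gt1.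
have -> : moment 1 n = wp_poly 0 n.
  apply: eq_cleared_sum => j; rewrite /wp_num /wp_den ?hornerC; ring.
have dvd_wp := wp_poly_shift n p_pr.
rewrite wp_poly_odd_square // /odd_square_value in dvd_wp.
move: dvd_wp (half_sq_shift n p_pr n_gt1).
set p : int := (2 * n + 1)%:R; set P := \prod_(j < n) _; set C := half_sq n.
move=> dvd_wp dvd_P; rewrite (_ : _ - _ = wp_poly 0 n - C * (p * P) + C * (p * (P - C))).
  by rewrite rpredD // dvdz_mull // exprS dvdz_mul.
by ring.
Qed.

(** * Back to rational numbers *)

Lemma p_integral_frac p (a d : int) : coprime p `|d|%N ->
  p_integral p (a%:~R / d%:~R).
Proof.
move=> cop_d; have [->|nz_d] := eqVneq d 0.
  by rewrite invr0 mulr0 /p_integral coprimen1.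
rewrite /p_integral; apply: coprime_dvdr cop_d.
set x : rat := _ / _.
have numx : numq x * d = a * denq x.
  apply: (@intr_inj rat); rewrite !rmorphM /= numqE /x; field.
  by rewrite intr_eq0.
have : (denq x %| numq x * d)%Z by rewrite numx dvdz_mull.
by rewrite Gauss_dvdzr // coprimezE coprime_sym coprime_num_den.
Qed.

Lemma eqmod_local_frac (p N : nat) (a c d e z : int) :
    coprime p `|d|%N -> coprime p `|e|%N -> d != 0 -> e != 0 ->
    a * e - c * d = N%:R * z ->
  eqmod_local p N (a%:~R / d%:~R) (c%:~R / e%:~R).
Proof.
move=> cop_d cop_e nz_d nz_e def_z; split; try exact: p_integral_frac.
exists (z%:~R / (d * e)%:~R).
  by apply: p_integral_frac; rewrite abszM coprimeMr cop_d.
have nz_dq : d%:~R != 0 :> rat by rewrite intr_eq0.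
have nz_eq : e%:~R != 0 :> rat by rewrite intr_eq0.
have /(congr1 (fun x : int => x%:~R : rat)) := def_z.
rewrite rmorphB !rmorphM rmorph_nat /= => def_zq.
rewrite mulrA -def_zq; by field; rewrite ?nz_dq ?nz_eq.
Qed.

Lemma risingE k : rising (1 / 2%:R) k / rising 1 k =
  \prod_(j < k) ((2 * j + 1)%:R / (2 * j + 2)%:R).
Proof.
rewrite /rising -prodf_div; apply: eq_bigr => j _.
have j_ge0 : 0 <= (j : nat)%:R :> rat by [].
by field; do ?[apply/andP; split]=> //; apply: lt0r_neq0; lra.
Qed.

Lemma S_sum_moment mu n :
  S_sum (2 * mu + 1) (2 * n + 1) =
    (moment 'X^mu n)%:~R / (half_sq n ^+ 2)%:~R.
Proof.
have nz j : (2 * j + 2)%:R != 0 :> rat by rewrite pnatr_eq0; lia.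
have nz_C : (half_sq n ^+ 2)%:~R != 0 :> rat.
  rewrite intr_eq0 expf_eq0 /=; apply/prodf_neq0 => j _.
  by rewrite expf_eq0 /= pnatr_eq0; lia.
apply: (mulIf nz_C); rewrite divfK //.
rewrite -[RHS]/((intr : {rmorphism int -> rat}) _) rmorph_cleared_sum.
rewrite cleared_sum_field; last by move=> j _ /=; rewrite rmorphXn rmorph_nat expf_neq0.
rewrite mulrC; congr (_ * _).
  rewrite rmorphXn rmorph_prod -prodrXl; apply: eq_bigr => j _.
  by rewrite -rmorphXn /= -exprM.
rewrite /S_sum (_ : ((2 * n + 1 - 1)./2 = n)%N); last by lia.
rewrite big_mkord; apply: eq_bigr => k _.
rewrite risingE -prodrXl /= rmorphM rmorph_nat hornerXn; congr (_ * _).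
  by rewrite [(2 * mu + 1)%N]addn1 exprS exprM !rmorphXn rmorph_nat.
apply: eq_bigr => j _.
by rewrite expr_div_n !rmorphXn !rmorph_nat.
Qed.

Lemma coprime_half_sq n : prime (2 * n + 1) -> coprime (2 * n + 1) `|half_sq n|%N.
Proof.
move=> p_pr; apply: (big_rec (fun C : int => coprime (2 * n + 1) `|C|)).
  exact: coprimen1.
move=> j C _ cop_C; rewrite abszM abszX coprimeMr cop_C andbT coprimeXr // natz.
by apply: coprime_small_prime; have := ltn_ord j; lia.
Qed.

(** For n = 1 the moments are 21 and 3141 = 9 * 349, so 81 can only divide the
    difference if 9 divides 21 a, that is, if 3 divides a. *)
Lemma moment_descent_mod3 (a : int) :
  (81 %| 2 * moment 'X^2 1 - a * moment 1 1)%Z -> (3 %| a)%Z.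
Proof.
have -> : moment 'X^2 1 = 3141.
  by rewrite /moment cleared_sumS cleared_sum0 big_ord1 !hornerXn.
have -> : moment 1 1 = 21.
  by rewrite /moment cleared_sumS cleared_sum0 big_ord1 !hornerC.
move=> H; lia.
Qed.

Theorem theorem5 (m : nat) (hm : odd m) :
  let mu := ((m - 1)./2)%N in
  exists a : int, forall p : nat,
    prime p -> odd p -> (mu < p)%N ->
    (* for m = 1 and m = 3 the congruence fails at p = 3 *)
    (p = 3%N -> (3 < m)%N) ->
    eqmod_local p (p ^ 4)%N (S_sum m p) (a%:~R / (mu`!)%:R * p%:R).
Proof.
move=> mu; have def_m : m = (2 * mu + 1)%N by rewrite /mu; lia.
have [|a descent] := @moment_descent mu 'X^mu; first by rewrite size_polyXn.
exists a => p p_pr p_odd lt_mu_p not_small.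
pose n := p./2; have def_p : p = (2 * n + 1)%N by rewrite /n; lia.
have p_gt2 : (2 < p)%N by rewrite odd_prime_gt2.
suff /dvdzP[z def_z] : (p%:R ^+ 4 %|
    mu`!%:R * moment 'X^mu n - a * p%:R * half_sq n ^+ 2)%Z.
  have -> : a%:~R / mu`!%:R * p%:R = (a * p%:R)%:~R / (mu`!%:R : int)%:~R :> rat.
    by rewrite rmorphM !rmorph_nat mulrAC.
  have nz_C : half_sq n ^+ 2 != 0.
    rewrite expf_eq0 /=; apply/prodf_neq0 => j _.
    by rewrite expf_eq0 /= pnatr_eq0; lia.
  have -> : S_sum m p = S_sum (2 * mu + 1) (2 * n + 1) by rewrite -def_m -def_p.
  rewrite S_sum_moment.
  apply: (@eqmod_local_frac _ _ _ _ _ _ z) => //.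
  - by rewrite abszX coprimeXr // def_p coprime_half_sq // -def_p.
  - rewrite natz /= fact_prod big_seq.
    apply: (big_rec (fun C => coprime p C)) => [|j C]; first exact: coprimen1.
    rewrite mem_index_iota => /andP[j_gt0 le_j] cop_C.
    rewrite coprimeMr cop_C andbT coprime_small_prime // j_gt0.
    exact: leq_trans le_j lt_mu_p.
  - by rewrite pnatr_eq0 -lt0n fact_gt0.
  - by rewrite natrX [RHS]mulrC -def_z mulrC.
have := descent n; rewrite -def_p => dvd_descent.
suff dvd_base : (p%:R ^+ 4 %| a * (moment 1 n - p%:R * half_sq n ^+ 2))%Z.
  rewrite (_ : _ - _ = mu`!%:R * moment 'X^mu n - a * moment 1 n
     + a * (moment 1 n - p%:R * half_sq n ^+ 2)); last by ring.
  by rewrite rpredD.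
have [n_le1|n_gt1] := leqP n 1; last first.
  by rewrite dvdz_mull // def_p moment1_mod // -def_p.
(* Only p = 3 and m = 5 remain. *)
have n1 : n = 1%N by lia.
have p3 : p = 3%N by rewrite def_p n1.
have mu2 : mu = 2%N by have := not_small p3; lia.
move: dvd_descent; rewrite n1 mu2 p3.
move=> /moment_descent_mod3/dvdzP[b ->].
(* 21 - 3 * 4 ^ 2 *)
rewrite (_ : moment 1 1 - _ = -27).
  by rewrite -mulrA dvdz_mull.
by rewrite /moment cleared_sumS cleared_sum0 /half_sq !big_ord1 !hornerC.
Qed.
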